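(* Let $n,q,d$ be positive integers with $q\ge 2$ and $d\le n$, and let $H(n,q,d)$ denote the $q$-ary Hamming graph of length $n$ with distance $d$. \begin{enumerate} \item If $d\ge \frac{(q-1)n}{q}$, then $\chi_Q(H(n,q,d))\le qd$. \item If $\frac{(q-1)n}{q}-\frac{\sqrt{(q-1)n}}{q}<d<\frac{(q-1)n}{q}$, then $\chi_Q(H(n,q,d))\le 2(q-1)^2\binom{n}{2}$. \item If $d=\delta n$ for some fixed $0<\delta<\frac{q-1}{q}$, then (as $n\to\infty$ over those $n$ for which $\delta n$ is an integer) $$\chi_Q(H(n,q,d))\le q^{h_q\left(\frac{q-1-(q-2)\delta-2\sqrt{(q-1)\delta(1-\delta)}}{q}\right)n+o(n)},$$ where $h_q(x)=x\log_q(q-1)-x\log_q x-(1-x)\log_q(1-x)$ is the $q$-ary entropy function. \end{enumerate}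
   Context: For a $q$-element alphabet $\Sigma$, the Hamming graph $H(n,q,d)$ has vertex set $\Sigma^n$, two vertices being adjacent iff they differ in exactly $d$ coordinates. A quantum homomorphism from a graph $G$ to a graph $H$ is a family of Hermitian matrices $\{P_{v,\alpha}: v\in V(G),\alpha\in V(H)\}\subseteq\mathbb{C}^{k\times k}$ (some $k\ge1$) such that (1) for each $v$, $\sum_\alpha P_{v,\alpha}=I$ and $P_{v,\alpha}P_{v,\beta}=\delta_{\alpha\beta}P_{v,\alpha}$; (2) $P_{u,\alpha}P_{v,\beta}=0$ whenever $u,v$ are adjacent in $G$ and $\alpha,\beta$ are non-adjacent in $H$ (in particular when $\alpha=\beta$). The quantum chromatic number $\chi_Q(G)$ is the least $r$ such that there is a quantum homomorphism from $G$ to the complete graph $K_r$. *)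

(* Defs.v *)
From mathcomp Require Import all_boot all_order all_algebra.
From mathcomp Require Import sesquilinear complex.
From mathcomp Require Import all_classical all_reals all_analysis.

Set Implicit Arguments.
Unset Strict Implicit.
Unset Printing Implicit Defensive.

Import Order.TTheory GRing.Theory Num.Theory numFieldNormedType.Exports.

Local Open Scope ring_scope.

Record sgraph := SGraph {
  vertex :> finType;
  adj : rel vertex;
  adj_sym : symmetric adj;
  adj_irrefl : irreflexive adj }.

Section CompleteGraph.
Variable r : nat.

Definition complete_adj : rel 'I_r := fun a b => a != b.

Fact complete_adj_sym : symmetric complete_adj.
Proof. by move=> a b; rewrite /complete_adj eq_sym. Qed.

Fact complete_adj_irrefl : irreflexive complete_adj.
Proof. by move=> a; rewrite /complete_adj eqxx. Qed.

Definition complete_graph := SGraph complete_adj_sym complete_adj_irrefl.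

End CompleteGraph.

Section Hamming.
Variables (Sigma : finType) (n : nat).
Implicit Types x y : n.-tuple Sigma.

Definition hamming_dist x y : nat := #|[set i | tnth x i != tnth y i]|.

Fact hamming_adj_sym d : symmetric (fun x y => hamming_dist x y == d).
Proof.
move=> x y /=; congr (_ == d); rewrite /hamming_dist.
by apply: eq_card => i; rewrite !inE eq_sym.
Qed.

Fact hamming_adj_irrefl d : (0 < d)%N ->
  irreflexive (fun x y => hamming_dist x y == d).
Proof.
case: d => // d _ x /=; rewrite /hamming_dist eq_card0 // => i.
by rewrite !inE eqxx.
Qed.

(* The positivity of the distance is what makes the relation irreflexive. *)
Definition hamming_graph d (d_gt0 : (0 < d)%N) :=
  SGraph (hamming_adj_sym d) (hamming_adj_irrefl d_gt0).

End Hamming.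

Record quantum_hom (R : realType) (G H : sgraph) (k : nat)
    (P : G -> H -> 'M[R[i]]_k) : Prop := QuantumHom {
  qhom_herm : forall v a, P v a \is hermsymmx;
  qhom_sum : forall v, \sum_a P v a = 1%:M;
  qhom_orth : forall v a b, P v a *m P v b = if a == b then P v a else 0;
  qhom_adj : forall u v a b, adj u v -> ~~ adj a b -> P u a *m P v b = 0 }.

Definition has_quantum_hom (R : realType) (G H : sgraph) : Prop :=
  exists k : nat, (0 < k)%N /\
    exists P : G -> H -> 'M[R[i]]_k, quantum_hom P.

Definition quantum_colorable (R : realType) (G : sgraph) : pred nat :=
  fun r => `[< has_quantum_hom R G (complete_graph r) >].

(* Colouring every vertex with its own colour, by 1 x 1 matrices. *)
Lemma quantum_colorable_ex (R : realType) (G : sgraph) :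
  exists r, quantum_colorable R G r.
Proof.
exists #|G|; apply/asboolP; exists 1%N; split=> //.
pose P (v : G) (a : complete_graph #|G|) : 'M[R[i]]_1 :=
  (enum_rank v == a)%:R%:M.
exists P; split=> [v a|v|v a b|u v a b uv].
- apply/is_hermitianmxP; rewrite expr0 scale1r /P tr_scalar_mx map_scalar_mx.
  by rewrite /= conjC_nat.
- rewrite (bigD1 (enum_rank v)) //= big1 ?addr0 /P ?eqxx // => a.
  by rewrite eq_sym => /negPf ->; rewrite raddf0.
- rewrite /P -scalar_mxM; have [<-|ab] := eqVneq a b.
    by case: eqP; rewrite ?mulr1 ?mulr0.
  have [va|_] := eqVneq (enum_rank v) a; last by rewrite mul0r raddf0.
  by rewrite va (negPf ab) mulr0 raddf0.
- rewrite /= /complete_adj negbK => /eqP <-; rewrite /P -scalar_mxM.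
  have [ua|_] := eqVneq (enum_rank u) a; last by rewrite mul0r raddf0.
  have [va|_] := eqVneq (enum_rank v) a; last by rewrite mulr0 raddf0.
  have e : u = v by apply: enum_rank_inj; rewrite ua va.
  by move: uv; rewrite e adj_irrefl.
Qed.

Definition chiQ (R : realType) (G : sgraph) : nat :=
  ex_minn (quantum_colorable_ex R G).

Section Entropy.
Variables (R : realType) (q : nat).

Definition logq (x : R) : R := ln x / ln q%:R.

Definition hq (x : R) : R :=
  x * logq (q%:R - 1) - x * logq x - (1 - x) * logq (1 - x).

End Entropy.

(* Main.v *)
Require Import Defs.
From mathcomp Require Import all_boot all_order all_algebra.
From mathcomp Require Import sesquilinear complex.
From mathcomp Require Import all_classical all_reals all_analysis.
From mathcomp Require Import cyclic separable cyclotomic ring lra zify.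

(* A map f from the vertices of G to C^r with unimodular entries, orthogonal on
   adjacent vertices, gives a quantum r-colouring: conjugate the rank-one
   projections onto the Fourier basis of C^r by the diagonal unitaries
   diag (f v).  For the Hamming graph take as coordinates all characters of
   weight j, completed by m copies of the trivial character.  The inner product
   of two words at distance d is then K_j(d) + m, where K_j is the j-th
   Krawtchouk polynomial, so that m = - K_j(d) works whenever K_j(d) <= 0, and
   r = C(n,j) (q-1)^j - K_j(d) <= 2 C(n,j) (q-1)^j.

   The first two bounds are the cases j = 1 and j = 2.  For the third one, if
   K_0(d), K_1(d), ... were all positive, the three-term recurrence would force
   the ratios K_(j+1)(d) / K_j(d) to drop by a constant amount at each step as
   soon as j exceeds tau n, where tau is the argument of the entropy; hence some
   K_j(d) with j <= (tau + o(1)) n is nonpositive. *)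

Set Implicit Arguments.
Unset Strict Implicit.
Unset Printing Implicit Defensive.

Import Order.TTheory GRing.Theory Num.Theory numFieldNormedType.Exports.

Local Open Scope ring_scope.

(** * Unimodular orthogonal representations *)

Section Fourier.
Variable C : numClosedFieldType.

(** In characteristic 0 the polynomial [X^n - 1] is separable, so it has [n] distinct roots, and
    among [n] distinct [n]-th roots of unity one is primitive. *)
Lemma prim_root_exists n : (0 < n)%N -> exists z : C, n.-primitive_root z.
Proof.
move=> n_gt0; have [rs] := closed_field_poly_normal ('X^n - 1 : {poly C}).
rewrite (monicP (monicXnsubC _ n_gt0)) scale1r => rsE.
have: has n.-primitive_root rs.
  apply: has_prim_root => //.
  - by apply/allP => z; rewrite -root_prod_XsubC -rsE.
  - by rewrite -separable_prod_XsubC -rsE separable_Xn_sub_1 // pnatr_eq0 -lt0n.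
  - by rewrite -ltnS -(size_prod_XsubC rs id) -rsE size_XnsubC.
by case/hasP=> z _ zP; exists z.
Qed.

Lemma unimodular_inv (z : C) : z * z^* = 1 -> z^-1 = z^*.
Proof.
move=> zz; have z0 : z != 0.
  by apply: contra_eq_neq zz => ->; rewrite mul0r eq_sym oner_eq0.
by apply: (mulfI z0); rewrite divff.
Qed.

Lemma sum_expr_unity (r : nat) (w : C) : w ^+ r = 1 -> w != 1 ->
  \sum_(k < r) w ^+ k = 0.
Proof.
move=> wr w1; apply: (mulfI (x := w - 1)); first by rewrite subr_eq0.
by rewrite mulr0 -subrX1 wr subrr.
Qed.

(** The character table of the cyclic group of order [#|T|], with [t0] indexing the trivial
    character. It serves once for the colours and once for the alphabet. *)
Lemma fourier_matrix (T : finType) : (0 < #|T|)%N ->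
  exists (t0 : T) (F : T -> T -> C),
  [/\ forall a b, F a b * (F a b)^* = 1,
      forall b, F t0 b = 1,
      forall a b, \sum_k F a k * (F b k)^* = #|T|%:R *+ (a == b) &
      forall a b, \sum_k F k a * (F k b)^* = #|T|%:R *+ (a == b)].
Proof.
move=> T_gt0; have [z zP] := prim_root_exists T_gt0.
pose F (a b : T) := z ^+ (enum_rank a * enum_rank b).
have zz : z * z^* = 1.
  rewrite -normCK; apply/eqP; rewrite sqrf_eq1; apply/orP; left.
  by rewrite -(pexpr_eq1 T_gt0) // -normrX (prim_expr_order zP) normr1.
have FC a b : F a b = F b a by rewrite /F mulnC.
have Fsum a b : \sum_k F a k * (F b k)^* = #|T|%:R *+ (a == b).
  pose w := z ^+ enum_rank a / z ^+ enum_rank b.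
  rewrite (reindex _ (onW_bij _ (@enum_val_bij T))).
  have wE (k : 'I_#|T|) : F a (enum_val k) * (F b (enum_val k))^* = w ^+ k.
    rewrite /F enum_valK rmorphXn /= -(unimodular_inv zz) !exprM.
    by rewrite [z^-1 ^+ _]exprVn -exprMn.
  under eq_bigr do rewrite wE.
  have zb0 : z ^+ enum_rank b != 0 by rewrite expf_neq0 // (prim_root_eq0 zP) -lt0n.
  have [ab|ab] := eqVneq a b.
    have -> : w = 1 by rewrite /w ab divff.
    by under eq_bigr do rewrite expr1n; rewrite sumr_const card_ord.
  rewrite sum_expr_unity //.
    by rewrite expr_div_n ![_ ^+ _ ^+ #|T|]exprAC (prim_expr_order zP) !expr1n divr1.
  apply: contra ab => /eqP w1; apply/eqP/enum_rank_inj/val_inj => /=.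
  have /eqP : z ^+ enum_rank a = z ^+ enum_rank b.
    by rewrite -[RHS]mul1r -w1 divfK.
  by rewrite (eq_prim_root_expr zP) !modn_small // => /eqP.
exists (enum_val (Ordinal T_gt0)), F; split => //.
- by move=> a b; rewrite /F rmorphXn /= -exprMn zz expr1n.
- by move=> b; rewrite /F enum_valK.
- by move=> a b; rewrite -Fsum; apply: eq_bigr => k _; rewrite FC [F k b]FC.
Qed.
End Fourier.

Lemma quantum_colorable_flat (R : realType) (G : sgraph) (I : finType)
    (f : G -> I -> R[i]) :
  (0 < #|I|)%N -> (forall v i, f v i * (f v i)^* = 1) ->
  (forall u v, adj u v -> \sum_i f u i * (f v i)^* = 0) ->
  has_quantum_hom R G (complete_graph #|I|).
Proof.
move=> I_gt0 f1 f_adj; set r := #|I|.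
have r_card : (0 < #|'I_r|)%N by rewrite card_ord.
have [_ [F [F1 _ Frow Fcol]]] := fourier_matrix R[i] r_card.
have r0 : r%:R != 0 :> R[i] by rewrite pnatr_eq0 -lt0n.
pose g v (x : 'I_r) := f v (enum_val x).
pose P (v : G) (a : complete_graph r) : 'M[R[i]]_r :=
  \matrix_(x, y) (r%:R^-1 * (g v x * (g v y)^*) * (F a x * (F a y)^*)).
(* A product of two rank-one matrices is governed by one scalar, the sum over [k]: its [g] factors
   cancel when [u = v], its [F] factors when [a = b]. *)
have PME u v a b x y : (P u a *m P v b) x y =
    r%:R^-1 ^+ 2 * (g u x * (g v y)^*) * (F a x * (F b y)^*) *
    \sum_k (g v k * (g u k)^*) * (F b k * (F a k)^*).
  rewrite mxE mulr_sumr; apply: eq_bigr => k _; rewrite !mxE; ring.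
exists r; split=> //; exists P; split=> [v a|v|v a b|u v a b uv].
- apply/is_hermitianmxP; rewrite expr0 scale1r; apply/matrixP => x y.
  rewrite !mxE !rmorphM /= fmorphV /= !conjCK conjC_nat.
  by congr (_ * _ * _); exact: mulrC.
- apply/matrixP => x y; rewrite summxE !mxE.
  under eq_bigr do rewrite mxE.
  rewrite -mulr_sumr Fcol card_ord; have [<-|xy] := eqVneq x y.
    by rewrite f1 mulr1 mulVf.
  by rewrite !mulr0n mulr0.
- apply/matrixP => x y; rewrite PME.
  under eq_bigr do rewrite /g f1 mul1r.
  rewrite Frow card_ord [b == a]eq_sym.
  case: eqP => [->|_]; last by rewrite mulr0n mulr0 mxE.
  by rewrite mxE mulr1n; field.
- rewrite /= /complete_adj negbK => /eqP <-; apply/matrixP => x y.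
  rewrite PME mxE; under eq_bigr do rewrite F1 mulr1.
  rewrite adj_sym in uv; move: (f_adj _ _ uv).
  rewrite (reindex _ (onW_bij _ (@enum_val_bij I))) => {}uv.
  by rewrite [X in _ * X]uv mulr0.
Qed.

(** * Krawtchouk numbers *)

(* Generating polynomial of the Krawtchouk numbers, meaningful only for d <= n
   because of the truncated subtraction. *)
Definition krawtchouk_poly (q n d : nat) : {poly int} :=
  (1 + (q%:R - 1)%:P * 'X) ^+ (n - d) * (1 - 'X) ^+ d.

Definition krawtchouk (q n d j : nat) : int := (krawtchouk_poly q n d)`_j.

Lemma krawtchouk0 q n j :
  (0 < q)%N -> krawtchouk q n 0 j = ('C(n, j) * (q - 1) ^ j)%:Z.
Proof.
move=> q_gt0; rewrite /krawtchouk /krawtchouk_poly expr0 mulr1 subn0.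
rewrite exprDn coef_sum.
under eq_bigr do rewrite expr1n mul1r exprMn -rmorphXn coefMn coefCM coefXn /=.
have [jn|jn] := leqP j n; last first.
  rewrite bin_small // mul0n big1 // => i _.
  by rewrite gtn_eqF ?mulr0 ?mul0rn //; have := ltn_ord i; lia.
rewrite (bigD1 (Ordinal (jn : (j < n.+1)%N))) //= eqxx mulr1 big1 ?addr0 => [|i ij].
  by rewrite -natz natrM natrX natrB // mulr_natl.
by rewrite [j == _]eq_sym (negPf (ij : (i : nat) != j)) mulr0 mul0rn.
Qed.

Lemma map_krawtchouk_poly (R : comNzRingType) q n d :
  map_poly (intr : int -> R) (krawtchouk_poly q n d) =
  (1 + (q%:R - 1)%:P * 'X) ^+ (n - d) * (1 - 'X) ^+ d.
Proof.
pose f : {rmorphism {poly int} -> {poly R}} := map_poly intr.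
rewrite /krawtchouk_poly -[LHS]/(f _) rmorphM !rmorphXn.
rewrite [f (1 + _)]rmorphD [f (1 - _)]rmorphB rmorphM rmorph1.
by rewrite /f /= map_polyX map_polyC /= rmorphB rmorph1 rmorph_nat.
Qed.

Definition dominated (p r : {poly int}) := forall i, `|p`_i| <= r`_i.

Lemma dominatedM p r p' r' :
  dominated p r -> dominated p' r' -> dominated (p * p') (r * r').
Proof.
move=> pr pr' k; rewrite !coefM; apply: le_trans (ler_norm_sum _ _ _) _.
by apply: ler_sum => i _; rewrite normrM ler_pM.
Qed.

Lemma dominatedX p r m : dominated p r -> dominated (p ^+ m) (r ^+ m).
Proof.
move=> pr; elim: m => [|m IHm]; last by rewrite !exprS; apply: dominatedM.
by move=> i; rewrite !expr0 coef1 normr_nat.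
Qed.

(** [1 - X] is dominated by [1 + (q - 1) X] because [q >= 2], and domination is multiplicative. *)
Lemma normr_krawtchouk_le q n d j : (1 < q)%N -> (d <= n)%N ->
  `|krawtchouk q n d j| <= krawtchouk q n 0 j.
Proof.
move=> q_gt1 dn; rewrite /krawtchouk /krawtchouk_poly expr0 mulr1 subn0.
rewrite -[in leRHS](subnK dn) exprD; apply: dominatedM; apply: dominatedX => i.
  by rewrite !coefE; case: i => [|[|i]] /=; lia.
by rewrite !coefE; case: i => [|[|i]] /=; lia.
Qed.

(** * Differential equation and three-term recurrence *)

Lemma deriv_exp_mul (p : {poly int}) m :
  (p ^+ m)^`() * p = m%:R * p^`() * p ^+ m.
Proof.
case: m => [|m]; first by rewrite expr0 derivC !mul0r.
by rewrite deriv_exp /= -mulr_natl exprS; ring.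
Qed.

(** The logarithmic derivative of [A^(n-d) B^d], with [A = 1 + c X] and [B = 1 - X], cleared of
    denominators by [A B = 1 + (c - 1) X - c X^2]. *)
Lemma krawtchouk_poly_ode q n d : (d <= n)%N ->
  let P := krawtchouk_poly q n d in let c : int := q%:R - 1 in
  P^`() + (c - 1)%:P * (P^`() * 'X) - c%:P * (P^`() * 'X * 'X) =
  (c * n%:R - q%:R * d%:R)%:P * P - (c * n%:R)%:P * (P * 'X).
Proof.
move=> dn P c; rewrite /P /krawtchouk_poly -/c derivM.
have -> : (c * n%:R - q%:R * d%:R)%:P =
    c%:P * n%:R - (c%:P + 1) * d%:R :> {poly int}.
  by rewrite /c !(polyCB, polyCM, polyC_natr); ring.
have -> : (c * n%:R)%:P = c%:P * n%:R :> {poly int} by rewrite polyCM polyC_natr.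
have -> : (c - 1)%:P = c%:P - 1 :> {poly int} by rewrite polyCB.
set A := 1 + c%:P * 'X; set B := 1 - 'X.
have dA : A^`() = c%:P.
  by rewrite /A !poly.derivE; ring.
have dB : B^`() = -1 by rewrite /B !poly.derivE sub0r.
have := deriv_exp_mul A (n - d); have := deriv_exp_mul B d.
rewrite dA dB natrB // => hB hA.
set A' := (A ^+ (n - d))^`() in hA *; set B' := (B ^+ d)^`() in hB *.
transitivity ((A' * A) * (B ^+ d * B) + A ^+ (n - d) * A * (B' * B)).
  by rewrite /A /B; ring.
by rewrite hA hB /A /B; ring.
Qed.

Lemma krawtchouk_j0 q n d : krawtchouk q n d 0 = 1.
Proof.
rewrite /krawtchouk -horner_coef0 /krawtchouk_poly !hornerE.
by rewrite ?mulr0 ?addr0 ?subr0 !expr1n ?mulr1.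
Qed.

Lemma krawtchouk_j1 q n d : (d <= n)%N ->
  krawtchouk q n d 1 = (q%:R - 1) * n%:R - q%:R * d%:R.
Proof.
move=> dn; have /(congr1 (fun p : {poly int} => p`_0)) := krawtchouk_poly_ode q dn.
rewrite !(coefD, coefN, coefCM, coefMX, coef_deriv) /=.
rewrite -!/(krawtchouk _ _ _ _) krawtchouk_j0.
by rewrite mulr1n !mulr0 addr0 !subr0 mulr1.
Qed.

(** This is the coefficient of [X^(j+1)] in the differential equation. *)
Lemma krawtchouk_rec q n d j : (d <= n)%N ->
  j.+2%:R * krawtchouk q n d j.+2 =
  ((q%:R - 1) * n%:R - q%:R * d%:R - (q%:R - 2) * j.+1%:R) * krawtchouk q n d j.+1
  - (q%:R - 1) * (n%:R - j%:R) * krawtchouk q n d j.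
Proof.
move=> dn; have /(congr1 (fun p : {poly int} => p`_j.+1)) := krawtchouk_poly_ode q dn.
rewrite !(coefD, coefN, coefCM, coefMX, coef_deriv) /=.
case: j => [|j] /=; rewrite -!/(krawtchouk _ _ _ _).
  by rewrite -[_ *+ 2]mulr_natl mulr1n mulr0 subr0 => /(canRL (addrK _)) ->; ring.
rewrite -[_ *+ j.+3]mulr_natl -[_ *+ j.+2]mulr_natl -[_ *+ j.+1]mulr_natl.
by move=> /(canRL (subrK _))/(canRL (addrK _)) ->; ring.
Qed.

(** * The colouring of the Hamming graph *)

Section HammingRep.
Variables (C : numClosedFieldType) (Sigma : finType) (n : nat) (t0 : Sigma).
Variable F : Sigma -> Sigma -> C.
Hypothesis F1 : forall a b, F a b * (F a b)^* = 1.
Hypothesis Ft0 : forall b, F t0 b = 1.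
Hypothesis Fcol : forall a b, \sum_k F k a * (F k b)^* = #|Sigma|%:R *+ (a == b).

Definition weight (a : {ffun 'I_n -> Sigma}) := #|[set i | a i != t0]|.

Definition wchar (x : n.-tuple Sigma) (a : {ffun 'I_n -> Sigma}) : C :=
  \prod_i F (a i) (tnth x i).

Lemma wchar_unit x a : wchar x a * (wchar x a)^* = 1.
Proof. by rewrite rmorph_prod -big_split big1 //= => i _; exact: F1. Qed.

(* Both sides factor over the positions i < n: the i-th factor is 1 + (q - 1) X
   where x and y agree and 1 - X where they differ. *)
Lemma sum_wchar_weight x y :
  \sum_a (wchar x a * (wchar y a)^*) *: 'X^(weight a) =
  map_poly intr (krawtchouk_poly #|Sigma| n (hamming_dist x y)).
Proof.
pose G i b : {poly C} := (F b (tnth x i) * (F b (tnth y i))^*) *: 'X^(b != t0).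
transitivity (\sum_(a : {ffun 'I_n -> Sigma}) \prod_i G i (a i)).
  apply: eq_bigr => a _; rewrite /G scaler_prod /wchar rmorph_prod -big_split /=.
  congr (_ *: _); rewrite prodrXr; congr ('X^ _).
  by rewrite /weight -sum1dep_card big_mkcond; apply: eq_bigr => i _; case: ifP.
rewrite -bigA_distr_bigA /=.
have GE i : \sum_b G i b = if tnth x i == tnth y i
    then 1 + (#|Sigma|%:R - 1)%:P * 'X else 1 - 'X.
  rewrite (bigD1 t0) //= {1}/G eqxx expr0 !Ft0 rmorph1 mul1r scale1r.
  (* By [Fcol] the full sum over [b] is [q] or 0; removing the trivial character subtracts 1. *)
  have -> : \sum_(b | b != t0) G i b =
      (#|Sigma|%:R *+ (tnth x i == tnth y i) - 1)%:P * 'X.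
    rewrite -Fcol [in RHS](bigD1 t0) //= !Ft0 rmorph1 mul1r [1 + _]addrC addrK.
    rewrite raddf_sum mulr_suml; apply: eq_bigr => b bt0.
    by rewrite /G bt0 expr1 mul_polyC.
  by case: eqP => _; rewrite ?mulr1n // mulr0n sub0r rmorphN rmorph1 mulN1r.
rewrite (eq_bigr _ (fun i _ => GE i)) (bigID (fun i => tnth x i == tnth y i)) /=.
rewrite (eq_bigr (fun=> 1 + (#|Sigma|%:R - 1)%:P * 'X)) => [|i ->//].
rewrite [X in _ * X](eq_bigr (fun=> 1 - 'X)) => [|i /negPf ->//].
have dE : #|[pred i | tnth x i != tnth y i]| = hamming_dist x y.
  by rewrite /hamming_dist cardsE.
rewrite !prodr_const dE.
have -> : #|[pred i | tnth x i == tnth y i]| = (n - hamming_dist x y)%N.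
  suff /eqP : (#|[pred i | tnth x i == tnth y i]| + hamming_dist x y = n)%N by lia.
  by rewrite -dE -[RHS]card_ord -[RHS](cardC [pred i | tnth x i == tnth y i]).
by rewrite map_krawtchouk_poly.
Qed.

Lemma sum_wchar x y j : \sum_(a | weight a == j) wchar x a * (wchar y a)^* =
  (krawtchouk #|Sigma| n (hamming_dist x y) j)%:~R.
Proof.
rewrite /krawtchouk -coef_map -sum_wchar_weight coef_sumMXn.
by apply: eq_bigl => a; rewrite eq_sym.
Qed.

End HammingRep.

(** * From a nonpositive Krawtchouk number to a colouring *)

Lemma chiQ_le (R : realType) (G : sgraph) r :
  has_quantum_hom R G (complete_graph r) -> (chiQ R G <= r)%N.
Proof.
move=> hr; rewrite /chiQ; case: ex_minnP => m _; apply.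
exact/asboolP.
Qed.

Lemma chiQ_hamming_le (R : realType) (Sigma : finType) n d (d_gt0 : (0 < d)%N) j :
  (1 < #|Sigma|)%N -> (j <= n)%N -> krawtchouk #|Sigma| n d j <= 0 ->
  (chiQ R (hamming_graph Sigma n d_gt0) <=
    'C(n, j) * (#|Sigma| - 1) ^ j + `|krawtchouk #|Sigma| n d j|)%N.
Proof.
move=> q_gt1 jn Kle0; set m := absz _.
have [t0 [F [F1 Ft0 _ Fcol]]] := fourier_matrix R[i] (ltnW q_gt1).
pose A := [pred a : {ffun 'I_n -> Sigma} | weight t0 a == j].
pose W : finType := {a in A}.
have sumW (g : {ffun 'I_n -> Sigma} -> R[i]) :
    \sum_(a : W) g (val a) = \sum_(a | weight t0 a == j) g a.
  by rewrite -(big_sub A).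
have cardW : #|W| = ('C(n, j) * (#|Sigma| - 1) ^ j)%N.
  (* Each character contributes 1 when a word is paired with itself, so the character sum at
     distance 0 counts the characters of weight [j]. *)
  pose x0 := [tuple of nseq n t0].
  have := sum_wchar Ft0 Fcol x0 x0 j.
  under eq_bigr do rewrite wchar_unit //.
  rewrite -sumW sumr_const /hamming_dist.
  rewrite [#|[set i | _]|]eq_card0 => [|i]; last by rewrite !inE eqxx.
  rewrite krawtchouk0 ?(ltnW q_gt1) // => /eqP.
  by rewrite -pmulrn eqr_nat => /eqP.
pose f (x : hamming_graph Sigma n d_gt0) (i : W + 'I_m) : R[i] :=
  match i with inl a => wchar F x (val a) | inr _ => 1 end.
rewrite -cardW -[m]card_ord -card_sum.
apply: chiQ_le; apply: (@quantum_colorable_flat _ _ _ f).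
- rewrite card_sum cardW; apply: ltn_addr.
  by rewrite muln_gt0 bin_gt0 jn expn_gt0 subn_gt0 q_gt1.
- by move=> x [a|k] /=; rewrite ?wchar_unit // rmorph1 mulr1.
- move=> x y /eqP xy; rewrite big_sumType /=.
  rewrite (sumW (fun a => wchar F x a * (wchar F y a)^*)) (sum_wchar Ft0 Fcol) xy.
  rewrite rmorph1 mulr1 sumr_const card_ord /m pmulrn -intrD.
  by rewrite lez0_abs // subrr.
Qed.

Lemma chiQ_hamming_le2 (R : realType) (Sigma : finType) n d (d_gt0 : (0 < d)%N) j :
  (1 < #|Sigma|)%N -> (d <= n)%N -> (j <= n)%N -> krawtchouk #|Sigma| n d j <= 0 ->
  (chiQ R (hamming_graph Sigma n d_gt0) <= 2 * ('C(n, j) * (#|Sigma| - 1) ^ j))%N.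
Proof.
move=> q_gt1 dn jn Kle0; apply: leq_trans (chiQ_hamming_le R d_gt0 q_gt1 jn Kle0) _.
rewrite mul2n -addnn leq_add2l -lez_nat abszE -krawtchouk0 ?(ltnW q_gt1) //.
exact: normr_krawtchouk_le.
Qed.

(** For [j = 1] the padding is [q d - (q - 1) n], which brings the total to exactly [q d]. *)
Lemma chiQ_hamming_linear (R : realType) (Sigma : finType) n d (d_gt0 : (0 < d)%N) :
  (1 < #|Sigma|)%N -> (0 < n)%N -> (d <= n)%N -> ((#|Sigma| - 1) * n <= #|Sigma| * d)%N ->
  (chiQ R (hamming_graph Sigma n d_gt0) <= #|Sigma| * d)%N.
Proof.
move=> q_gt1 n_gt0 dn le_qd.
have K1 : krawtchouk #|Sigma| n d 1 = ((#|Sigma| - 1) * n)%:Z - (#|Sigma| * d)%:Z.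
  by rewrite krawtchouk_j1 // !PoszM -subzn ?(ltnW q_gt1) // !natz.
have Kle0 : krawtchouk #|Sigma| n d 1 <= 0 by rewrite K1 subr_le0 lez_nat.
apply: leq_trans (chiQ_hamming_le R d_gt0 q_gt1 n_gt0 Kle0) _.
rewrite bin1 expn1 K1; move: le_qd; rewrite mulnC; lia.
Qed.

Lemma krawtchouk_j2 q n d : (d <= n)%N ->
  2 * krawtchouk q n d 2 = ((q%:R - 1) * n%:R - q%:R * d%:R) ^+ 2
    - (q%:R - 2) * ((q%:R - 1) * n%:R - q%:R * d%:R) - (q%:R - 1) * n%:R.
Proof.
by move=> dn; rewrite krawtchouk_rec // krawtchouk_j0 krawtchouk_j1 //; ring.
Qed.

(** With [s = (q - 1) n - q d] one has [2 K_2 = s^2 - (q - 2) s - (q - 1) n], which is negative when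
    [s > 0] and [s^2 < (q - 1) n]. *)
Lemma chiQ_hamming_quadratic (R : realType) (Sigma : finType) n d (d_gt0 : (0 < d)%N) :
  let q : R := #|Sigma|%:R in
  (1 < #|Sigma|)%N -> (d <= n)%N ->
  0 < (q - 1) * n%:R - q * d%:R ->
  ((q - 1) * n%:R - q * d%:R) ^+ 2 < (q - 1) * n%:R ->
  (chiQ R (hamming_graph Sigma n d_gt0) <= 2 * (#|Sigma| - 1) ^ 2 * 'C(n, 2))%N.
Proof.
move=> q q_gt1 dn s_gt0 s_lt.
have q2 : 2 <= q by rewrite /q ler_nat.
(* Weight 2 requires [n >= 2]; otherwise [n = d = 1] and [s = -1]. *)
have n_ge2 : (2 <= n)%N.
  have [//|n1] := ltnP 1 n.
  have [d1 n1'] : d = 1%N /\ n = 1%N by lia.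
  by move: s_gt0; rewrite d1 n1' !mulr1; lra.
rewrite -mulnA [((_ ^ 2) * _)%N]mulnC.
apply: chiQ_hamming_le2 => //.
rewrite -(lerz0 R) -(pmulr_rle0 _ (ltr0Sn R 1)).
have /(congr1 (intr : int -> R)) := krawtchouk_j2 #|Sigma| dn.
rewrite !(rmorphXn, intrM, intrB, rmorph_nat) /= -/q => ->.
have : 0 <= (q - 2) * ((q - 1) * n%:R - q * d%:R).
  by apply: mulr_ge0; [rewrite subr_ge0 | exact: ltW].
lra.
Qed.

(** * Nonpositive Krawtchouk numbers and entropy *)

Section Ratio.
Variable R : archiRealFieldType.

(* As long as the K_j are positive, the ratio K_(j+1) / K_j is at most c / a1 at
   j = a1 n and drops by e at each later step, hence M steps make it negative. *)
Lemma recurrence_nonpos (c delta a1 a2 e : R) (K : nat -> R) (n M : nat) :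
  1 <= c -> 0 <= delta -> 0 < a1 -> a2 <= 1 -> 0 < e ->
  (forall a r, a1 <= a <= a2 -> 0 < r ->
     e <= a * r + c * (1 - a) / r - (c - (c + 1) * delta - (c - 1) * a)) ->
  (forall j, j.+2%:R * K j.+2 =
     (c * n%:R - (c + 1) * (delta * n%:R) - (c - 1) * j.+1%:R) * K j.+1
     - c * (n%:R - j%:R) * K j) ->
  c / a1 < M%:R * e -> M.+2%:R <= (a2 - a1) * n%:R -> (0 < n)%N ->
  exists2 j, j%:R <= a2 * n%:R & K j <= 0.
Proof.
move=> c1 d0 a10 a21 e0 key rec hM hn n_gt0.
have n0 : 0 < n%:R :> R by rewrite ltr0n.
have [//|noj] := pselect (exists2 j, j%:R <= a2 * n%:R & K j <= 0).
have Kpos j : j%:R <= a2 * n%:R -> 0 < K j.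
  by move=> ja; rewrite ltNge; apply/negP => Kj; apply: noj; exists j.
have a2n : a2 * n%:R <= n%:R by rewrite ler_piMl // ltW.
pose r j := K j.+1 / K j.
have rpos j : j.+1%:R <= a2 * n%:R -> 0 < r j.
  move=> ja; rewrite divr_gt0 ?Kpos //.
  by apply: le_trans ja; rewrite ler_nat.
have recr j : j.+2%:R <= a2 * n%:R -> j.+2%:R * r j.+1 =
    c * n%:R - (c + 1) * (delta * n%:R) - (c - 1) * j.+1%:R
    - c * (n%:R - j%:R) / r j.
  move=> ja.
  have j1a : j.+1%:R <= a2 * n%:R by apply: le_trans ja; rewrite ler_nat.
  have j0a : j%:R <= a2 * n%:R by apply: le_trans j1a; rewrite ler_nat.
  have K0 := lt0r_neq0 (Kpos _ j0a); have K1 := lt0r_neq0 (Kpos _ j1a).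
  rewrite /r mulrA rec; field; exact/andP.
have start j : a1 * n%:R <= j.+2%:R -> j.+2%:R <= a2 * n%:R -> r j.+1 <= c / a1.
  move=> aj ja; have rj := recr _ ja.
  have j1a : j.+1%:R <= a2 * n%:R by apply: le_trans ja; rewrite ler_nat.
  have jn : j%:R <= n%:R :> R.
    by apply: le_trans (le_trans ja a2n); rewrite ler_nat leqW.
  have : j.+2%:R * r j.+1 <= c * n%:R.
    have h1 : 0 <= (c + 1) * (delta * n%:R) by rewrite !mulr_ge0 ?ler0n //; lra.
    have h2 : 0 <= (c - 1) * j.+1%:R by rewrite mulr_ge0 // subr_ge0.
    have h3 : 0 <= c * (n%:R - j%:R) / r j.
      have := ltW (rpos _ j1a) => rj0.
      by apply: divr_ge0 => //; apply: mulr_ge0; lra.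
    rewrite rj; lra.
  have r0 : 0 < r j.+1 by apply: rpos.
  move=> h; rewrite ler_pdivlMr // -(ler_pM2r n0).
  apply: le_trans h; rewrite -mulrA mulrC ler_pM2r //.
have step j : a1 * n%:R <= j.+1%:R -> j.+2%:R <= a2 * n%:R -> r j.+1 <= r j - e.
  move=> aj ja; have rj := recr _ ja.
  have j1a : j.+1%:R <= a2 * n%:R by apply: le_trans ja; rewrite ler_nat.
  have r0 : 0 < r j by apply: rpos.
  have j2 : 0 < j.+2%:R :> R by [].
  rewrite -(ler_pM2l j2) rj.
  (* [key] is used at [a = (j + 1) / n] and scaled by [n]. Passing from [n - (j + 1)] to [n - j]
     only leaves the favourable term [- c / r j]. *)
  have := key (j.+1%:R / n%:R) (r j).
  rewrite ler_pdivlMr // ler_pdivrMr // aj j1a => /(_ isT r0) hk.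
  have : e * n%:R <= _ := ler_wpM2r (ltW n0) hk.
  have -> : (j.+1%:R / n%:R * r j + c * (1 - j.+1%:R / n%:R) / r j -
      (c - (c + 1) * delta - (c - 1) * (j.+1%:R / n%:R))) * n%:R =
    j.+1%:R * r j + c * (n%:R - j%:R) / r j - c / r j -
      (c * n%:R - (c + 1) * (delta * n%:R) - (c - 1) * j.+1%:R).
    by field; rewrite !gt_eqF.
  have : 0 < c / r j by rewrite divr_gt0 // (lt_le_trans ltr01).
  have : j.+2%:R * e <= e * n%:R.
    by rewrite mulrC ler_pM2l // (le_trans ja).
  have -> : j.+2%:R * (r j - e) = j.+1%:R * r j + r j - j.+2%:R * e by ring.
  lra.
pose t := Num.truncn (a1 * n%:R).
have /andP[t1 t2] : t%:R <= a1 * n%:R < t.+1%:R.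
  by apply: Num.Theory.truncn_itv; rewrite mulr_ge0 ?ltW.
have bound i : (t + i.+2)%:R <= a2 * n%:R -> r (t + i.+1)%N <= c / a1 - i%:R * e.
  elim: i => [|i IHi] ti.
    rewrite mul0r subr0 addn1; apply: start; last by rewrite -addn2.
    by rewrite (le_trans (ltW t2)) // ler_nat.
  rewrite addnS; have := step (t + i.+1)%N; rewrite -!addnS => st.
  apply: (le_trans (st _ ti)).
    by rewrite (le_trans (ltW t2)) // ler_nat addnS ltnS leq_addr.
  rewrite -natr1 mulrDl mul1r.
  have : r (t + i.+1)%N <= c / a1 - i%:R * e.
    by apply: IHi; apply: le_trans ti; rewrite ler_nat leq_add2l.
  lra.
(* After [M] drops the bound [c / a1 - M e] is negative, while the indices involved, up to
   [t + M + 2], are still at most [a2 n]. *)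
have tM : (t + M.+2)%:R <= a2 * n%:R by move: hn; rewrite natrD mulrBl; clearbody t; lra.
have := bound _ tM; have : 0 < r (t + M.+1)%N by apply: rpos; rewrite -addnS.
lra.
Qed.

End Ratio.

(* The smaller zero, as a function of a, of the discriminant
   A(a)^2 - 4 c a (1 - a) with A(a) = c - (c + 1) delta - (c - 1) a, which
   governs the scaled recurrence a r' = A(a) - c (1 - a) / r at j = a n. *)
Definition krawtchouk_root (R : rcfType) (c delta : R) : R :=
  (c - (c - 1) * delta - 2 * Num.sqrt (c * delta * (1 - delta))) / (c + 1).

(** * The critical density [tau] and the drop of the ratios *)

Section KrawtchoukRoot.
Variable R : rcfType.
Variables c delta : R.
Hypotheses (c0 : 0 < c) (d0 : 0 < delta) (dlt : delta < c / (c + 1)).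

Let tau := krawtchouk_root c delta.
(** For [0 <= a <= 1], [g(a)^2 - (c + 1) delta] equals [A(a) - 2 sqrt(c a (1 - a))], a factor of the
    discriminant. *)
Let g (a : R) := Num.sqrt (c * (1 - a)) - Num.sqrt a.

Lemma delta_lt1 : delta < 1.
Proof.
have c1 : 0 < c + 1 by rewrite addr_gt0.
by apply: lt_trans dlt _; rewrite ltr_pdivrMr // mul1r ltrDl.
Qed.

Lemma krawtchouk_root_sqr :
  tau = (Num.sqrt (c * (1 - delta)) - Num.sqrt delta) ^+ 2 / (c + 1).
Proof.
have d1 := delta_lt1.
have cd : 0 <= c * (1 - delta) by rewrite mulr_ge0 ?ltW // subr_gt0.
rewrite /tau /krawtchouk_root; congr (_ / _); rewrite sqrrB !sqr_sqrtr ?(ltW d0) //.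
rewrite -[c * delta * _]mulrAC (sqrtrM _ cd); ring.
Qed.

Lemma sqrt_delta_lt : Num.sqrt delta < Num.sqrt (c * (1 - delta)).
Proof.
have d1 := delta_lt1; rewrite ltr_sqrt ?mulr_gt0 ?subr_gt0 //.
have c1 : 0 < c + 1 by rewrite addr_gt0.
by move: dlt; rewrite ltr_pdivlMr //; lra.
Qed.

Lemma krawtchouk_root_gt0 : 0 < tau.
Proof.
rewrite krawtchouk_root_sqr divr_gt0 //; last by rewrite addr_gt0.
by rewrite exprn_gt0 // subr_gt0 sqrt_delta_lt.
Qed.

Lemma krawtchouk_root_lt : tau < c / (c + 1).
Proof.
have d1 := delta_lt1; rewrite krawtchouk_root_sqr ltr_pM2r ?invr_gt0 ?addr_gt0 //.
set s := Num.sqrt _; set t := Num.sqrt _.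
have st : t < s := sqrt_delta_lt.
have t0 : 0 < t by rewrite sqrtr_gt0.
have : s ^+ 2 < c.
  by rewrite sqr_sqrtr ?mulr_ge0 ?subr_ge0 ?ltW // gtr_pMr // ltrBlDr ltrDl.
by apply: lt_trans; rewrite ltr_pXn2r ?nnegrE //; lra.
Qed.

(** With [s], [t] the roots of [c (1 - delta)] and [delta], and [w^2 = c + 1], the two square roots
    in [g tau] are [(s + c t) / w] and [(s - t) / w]; their difference is [w t]. *)
Lemma g_root : g tau ^+ 2 = (c + 1) * delta /\ 0 < g tau.
Proof.
have d1 := delta_lt1; have tE := krawtchouk_root_sqr.
set s := Num.sqrt (c * (1 - delta)) in tE; set t := Num.sqrt delta in tE.
have st : t < s := sqrt_delta_lt.
have t0 : 0 < t by rewrite sqrtr_gt0.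
have s2 : s ^+ 2 = c * (1 - delta) by rewrite sqr_sqrtr // mulr_ge0 ?subr_ge0 ?ltW.
have t2 : t ^+ 2 = delta by rewrite sqr_sqrtr // ltW.
have c1 : 0 < c + 1 by rewrite addr_gt0.
set w := Num.sqrt (c + 1).
have w0 : 0 < w by rewrite sqrtr_gt0.
have w2 : w ^+ 2 = c + 1 by rewrite sqr_sqrtr // ltW.
have sq_tau : Num.sqrt tau = (s - t) / w.
  by rewrite tE -w2 -expr_div_n sqrtr_sqr ger0_norm // divr_ge0 ?subr_ge0 ?ltW.
have sq_tau' : Num.sqrt (c * (1 - tau)) = (s + c * t) / w.
  have -> : c * (1 - tau) = ((s + c * t) / w) ^+ 2.
    rewrite tE expr_div_n w2.
    have -> : (s + c * t) ^+ 2 = s ^+ 2 + c ^+ 2 * t ^+ 2 + 2 * c * (s * t) by ring.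
    have -> : (s - t) ^+ 2 = s ^+ 2 + t ^+ 2 - 2 * (s * t) by ring.
    by rewrite s2 t2; field; rewrite gt_eqF.
  by rewrite sqrtr_sqr ger0_norm // divr_ge0 ?addr_ge0 ?mulr_ge0 ?ltW // (lt_trans t0).
have gE : g tau = w * t.
  rewrite /g sq_tau sq_tau' -mulrBl; apply: (mulIf (lt0r_neq0 w0)).
  by rewrite divfK ?lt0r_neq0 // mulrAC -expr2 w2; ring.
by rewrite gE exprMn w2 t2 mulr_gt0.
Qed.

(* With X^2 = c (1 - a) and Y^2 = a the right-hand side equals
   (Y r - X)^2 / r + (c + 1) delta - (g a)^2, and g is decreasing. *)
Lemma ratio_drop a1 a2 : tau < a1 -> a1 <= a2 -> a2 <= c / (c + 1) ->
  exists2 e, 0 < e &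
  (forall a r, a1 <= a <= a2 -> 0 < r ->
     e <= a * r + c * (1 - a) / r - (c - (c + 1) * delta - (c - 1) * a)).
Proof.
move=> ta1 a12 a2c; have tau0 := krawtchouk_root_gt0; have [gt2 gt0] := g_root.
have c1 : 0 < c + 1 by rewrite addr_gt0.
have a_le a : a <= a2 -> a <= c * (1 - a).
  by move=> /le_trans/(_ a2c); rewrite ler_pdivlMr //; lra.
have g_ge0 a : 0 < a -> a <= a2 -> 0 <= g a.
  by move=> a0 /a_le aa; rewrite subr_ge0 ler_wsqrtr.
have a10 : 0 < a1 := lt_trans tau0 ta1.
(* Positive because [(c + 1) delta = g(tau)^2], [tau < a1], and [g] is strictly decreasing and
   nonnegative up to [c / (c + 1)]. *)
exists ((c + 1) * delta - g a1 ^+ 2).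
  rewrite subr_gt0 -gt2 ltr_pXn2r ?nnegrE ?(ltW gt0) ?g_ge0 //.
  rewrite /g ler_ltD // ?ltrN2 ?ltr_sqrt //.
  by rewrite ler_wsqrtr // ler_pM2l // lerD2l lerN2 ltW.
move=> a r /andP[aa1 aa2] r0; have a0 : 0 < a := lt_le_trans a10 aa1.
have : g a ^+ 2 <= g a1 ^+ 2.
  rewrite ler_pXn2r ?nnegrE ?g_ge0 //.
  by rewrite /g lerB ?ler_wsqrtr // ler_pM2l // lerD2l lerN2.
rewrite {1}/g; set X := Num.sqrt (c * _); set Y := Num.sqrt a.
have X2 : X ^+ 2 = c * (1 - a).
  by rewrite sqr_sqrtr // (le_trans (ltW a0)) // a_le.
have Y2 : Y ^+ 2 = a by rewrite sqr_sqrtr // ltW.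
have : 0 <= (Y * r - X) ^+ 2 / r by rewrite divr_ge0 ?sqr_ge0 // ltW.
have -> : (Y * r - X) ^+ 2 / r = Y ^+ 2 * r + X ^+ 2 / r - 2 * (X * Y).
  by field; rewrite gt_eqF.
have -> : (X - Y) ^+ 2 = X ^+ 2 + Y ^+ 2 - 2 * (X * Y) by ring.
rewrite X2 Y2; lra.
Qed.

End KrawtchoukRoot.

(* From 'C(n, j) t^j (1 - t)^(n - j) <= (t + (1 - t))^n.  Keeping t independent of
   j makes the bound affine in j, so monotonicity of the entropy is not needed. *)
Lemma ln_bin_le (R : realType) (n j : nat) (c t : R) :
  (j <= n)%N -> 0 < c -> 0 < t -> t < 1 ->
  ln ('C(n, j)%:R * c ^+ j) <=
    (t * ln c - t * ln t - (1 - t) * ln (1 - t)) * n%:R +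
    (j%:R - t * n%:R) * (ln c + ln (1 - t) - ln t).
Proof.
move=> jn c0 t0 t1; have t1' : 0 < 1 - t by rewrite subr_gt0.
have C0 : 0 < 'C(n, j)%:R :> R by rewrite ltr0n bin_gt0.
have : 'C(n, j)%:R * (t ^+ j * (1 - t) ^+ (n - j)) <= 1.
  rewrite -[leRHS](expr1n _ n) -[X in _ <= X ^+ n](subrK t) [leRHS]exprDn.
  rewrite (bigD1 (Ordinal (jn : (j < n.+1)%N))) //= [t ^+ j * _]mulrC mulr_natl lerDl.
  by apply: sumr_ge0 => i _; rewrite mulrn_wge0 // mulr_ge0 // exprn_ge0 // ltW.
rewrite -ler_ln ?posrE ?mulr_gt0 ?exprn_gt0 // ln1.
rewrite !lnM ?posrE ?mulr_gt0 ?exprn_gt0 // !lnXn //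
  -[ln t *+ _]mulr_natl -[ln (1 - t) *+ _]mulr_natl -[ln c *+ _]mulr_natl natrB //.
lra.
Qed.

(** * Asymptotic choice of the weight and the entropy bound *)

Lemma krawtchouk_nonpos_ev (R : realType) (q : nat) (delta eps : R) :
  let c : R := q%:R - 1 in
  let tau := krawtchouk_root c delta in
  (1 < q)%N -> 0 < delta -> delta < c / (c + 1) -> 0 < eps ->
  exists N : nat, forall n d : nat, (N <= n)%N -> (0 < n)%N -> (d <= n)%N ->
    d%:R = delta * n%:R ->
  exists j, [/\ (j <= n)%N, j%:R <= (tau + eps) * n%:R & krawtchouk q n d j <= 0].
Proof.
move=> c tau q_gt1 d0 dlt eps0.
have c1 : 1 <= c by rewrite /c lerBrDr -(natrD _ 1 1) ler_nat.
have c0 : 0 < c by apply: lt_le_trans c1.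
have cp : 0 < c + 1 by rewrite addr_gt0.
have tau0 : 0 < tau := krawtchouk_root_gt0 c0 d0 dlt.
have tauc : tau < c / (c + 1) := krawtchouk_root_lt c0 d0 dlt.
pose a2 := Num.min (tau + eps) (c / (c + 1)); pose a1 := (tau + a2) / 2.
have ta2 : tau < a2 by rewrite lt_min tauc andbT ltrDl.
have a2c : a2 <= c / (c + 1) by rewrite ge_min lexx orbT.
have a2e : a2 <= tau + eps by rewrite ge_min lexx.
have ta1 : tau < a1 by rewrite /a1; lra.
have a12 : a1 < a2 by rewrite /a1; lra.
have a21 : a2 <= 1.
  by apply: le_trans a2c _; rewrite ler_pdivrMr // mul1r lerDl.
have [e e0 key] := ratio_drop c0 d0 dlt ta1 (ltW a12) a2c.
have a10 : 0 < a1 := lt_trans tau0 ta1.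
(* [M] drops of size [e] exhaust the starting bound [c / a1]; [N] makes the window from [a1 n] to
   [a2 n] long enough for [M + 2] indices. *)
pose M := (Num.truncn (c / a1 / e)).+1.
have hM : c / a1 < M%:R * e.
  by rewrite -ltr_pdivrMr // truncnS_gt.
pose N := (Num.truncn (M.+2%:R / (a2 - a1))).+1.
exists N => n d Nn n_gt0 dn dE.
have hN : M.+2%:R <= (a2 - a1) * n%:R.
  rewrite mulrC -ler_pdivrMr ?subr_gt0 //.
  by apply: le_trans (ltW (truncnS_gt _)) _; rewrite ler_nat.
have rec j : j.+2%:R * (krawtchouk q n d j.+2)%:~R =
     (c * n%:R - (c + 1) * (delta * n%:R) - (c - 1) * j.+1%:R) * (krawtchouk q n d j.+1)%:~R
     - c * (n%:R - j%:R) * (krawtchouk q n d j)%:~R :> R.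
  have /(congr1 (intr : int -> R)) := krawtchouk_rec q j dn.
  rewrite !(intrM, intrB, rmorph_nat) -dE => ->.
  by rewrite /c; ring.
have [j ja Kj] := recurrence_nonpos c1 (ltW d0) a10 a21 e0 key rec hM hN n_gt0.
exists j; split.
- rewrite -(ler_nat R); apply: le_trans ja _.
  by rewrite ler_piMl.
- by apply: le_trans ja _; rewrite ler_pM2r ?ltr0n.
- by move: Kj; rewrite lerz0.
Qed.

Lemma chiQ_hamming_entropy_ev (R : realType) (Sigma : finType) (delta eps : R) :
  let c : R := #|Sigma|%:R - 1 in
  let tau := krawtchouk_root c delta in
  (1 < #|Sigma|)%N -> 0 < delta -> delta < c / (c + 1) -> 0 < eps ->
  exists N : nat, forall (n d : nat) (d_gt0 : (0 < d)%N),
    (N <= n)%N -> (0 < n)%N -> (d <= n)%N -> d%:R = delta * n%:R ->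
  logq #|Sigma| (chiQ R (hamming_graph Sigma n d_gt0))%:R <= (hq #|Sigma| tau + eps) * n%:R.
Proof.
move=> c tau q_gt1 d0 dlt eps0; set q := #|Sigma| in c tau q_gt1 d0 dlt eps0 *.
have c1 : 1 <= c by rewrite /c lerBrDr -(natrD _ 1 1) ler_nat.
have c0 : 0 < c by apply: lt_le_trans c1.
have cp : 0 < c + 1 by rewrite addr_gt0.
have tau0 : 0 < tau := krawtchouk_root_gt0 c0 d0 dlt.
have tauc : tau < c / (c + 1) := krawtchouk_root_lt c0 d0 dlt.
have tau1 : tau < 1.
  by apply: lt_le_trans tauc _; rewrite ler_pdivrMr // mul1r lerDl.
have lnq : 0 < ln q%:R :> R by rewrite ln_gt0 // ltr1n.
(* The slope in [j] of the bound [ln_bin_le], nonnegative because [tau <= c / (c + 1)]. *)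
pose B : R := ln c + ln (1 - tau) - ln tau.
have B0 : 0 <= B.
  have tau1' : 0 < 1 - tau by rewrite subr_gt0.
  have ct0 : 0 < c * (1 - tau) by exact: mulr_gt0.
  rewrite /B subr_ge0 -lnM ?posrE // ler_ln ?posrE //.
  by move: (ltW tauc); rewrite ler_pdivlMr //; lra.
(* Half of the error budget pays for the factor 2, half for the excess of [j] over [tau n]; dividing
   by [B + 1] below covers [B = 0]. *)
pose eta := eps * ln q%:R / 2.
have eta0 : 0 < eta by rewrite divr_gt0 ?mulr_gt0.
have B1 : 0 < B + 1 by rewrite (le_lt_trans B0) // ltrDl.
have [N1 hN1] := krawtchouk_nonpos_ev q_gt1 d0 dlt (divr_gt0 eta0 B1).
pose N2 := (Num.truncn (ln 2 / eta)).+1.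
exists (maxn N1 N2) => n d d_gt0; rewrite geq_max => /andP[n1 n2] n_gt0 dn dE.
have [j [jn ja Kj]] := hN1 n d n1 n_gt0 dn dE.
have chi_le := chiQ_hamming_le2 R d_gt0 q_gt1 dn jn Kj.
have n0 : 0 < n%:R :> R by rewrite ltr0n.
have C0 : 0 < 'C(n, j)%:R * c ^+ j.
  by rewrite mulr_gt0 ?exprn_gt0 // ltr0n bin_gt0.
have ln_chi : ln (chiQ R (hamming_graph Sigma n d_gt0))%:R <=
    ln 2 + ln ('C(n, j)%:R * c ^+ j) :> R.
  rewrite -lnM ?posrE //; move: chi_le; set x := chiQ _ _ => chi_le.
  have cE : (2 * ('C(n, j) * (q - 1) ^ j))%:R = 2 * ('C(n, j)%:R * c ^+ j) :> R.
    by rewrite !natrM natrX natrB // ltnW.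
  (* The convention [ln 0 = 0] is harmless, since the right-hand side is the logarithm of a number
     at least 1. *)
  have [->|x0] := posnP x.
    rewrite ln0 // ln_ge0 // -cE ler1n.
    by rewrite !muln_gt0 bin_gt0 jn expn_gt0 subn_gt0 q_gt1.
  have pos2 : 0 < 2 * ('C(n, j)%:R * c ^+ j) by exact: mulr_gt0.
  by rewrite ler_ln ?posrE ?ltr0n // -cE ler_nat.
have ln2 : ln 2 <= eta * n%:R.
  rewrite mulrC -ler_pdivrMr //.
  by apply: le_trans (ltW (truncnS_gt _)) _; rewrite ler_nat.
have jB : (j%:R - tau * n%:R) * B <= eta * n%:R.
  apply: (@le_trans _ _ ((eta / (B + 1) * n%:R) * B)).
    by rewrite ler_wpM2r // lerBlDl -mulrDl.
  by rewrite mulrAC ler_pM2r // mulrAC ler_pdivrMr // ler_pM2l // lerDl.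
rewrite /logq ler_pdivrMr //.
have lnC := ln_bin_le jn c0 tau0 tau1.
have -> : (hq q tau + eps) * n%:R * ln q%:R =
   (tau * ln c - tau * ln tau - (1 - tau) * ln (1 - tau)) * n%:R + eta * n%:R + eta * n%:R.
  by rewrite /hq /logq -/c /eta; field; rewrite gt_eqF.
apply: le_trans ln_chi _; apply: le_trans (lerD ln2 lnC) _; rewrite -/B; lra.
Qed.

(** * The three bounds *)

Local Open Scope classical_set_scope.
Local Open Scope ring_scope.

Theorem theorem1p1 (R : realType) (q : nat) (Sigma : finType)
    (q_ge2 : (2 <= q)%N) (card_Sigma : #|Sigma| = q) :
  [/\ (forall (n d : nat) (d_gt0 : (0 < d)%N), (0 < n)%N -> (d <= n)%N ->
        (q%:R - 1) * n%:R / q%:R <= d%:R :> R ->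
        (chiQ R (hamming_graph Sigma n d_gt0) <= q * d)%N),
      (forall (n d : nat) (d_gt0 : (0 < d)%N), (0 < n)%N -> (d <= n)%N ->
        (q%:R - 1) * n%:R / q%:R - Num.sqrt ((q%:R - 1) * n%:R) / q%:R
          < d%:R :> R ->
        d%:R < (q%:R - 1) * n%:R / q%:R :> R ->
        (chiQ R (hamming_graph Sigma n d_gt0)
          <= 2 * (q - 1) ^ 2 * 'C(n, 2))%N) &
      (forall delta : R, 0 < delta -> delta < (q%:R - 1) / q%:R ->
        exists2 e : nat -> R, e =o_\oo (fun n : nat => n%:R : R) &
          forall (n d : nat) (d_gt0 : (0 < d)%N), (0 < n)%N -> (d <= n)%N ->
          d%:R = delta * n%:R ->
          (chiQ R (hamming_graph Sigma n d_gt0))%:R <=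
            q%:R `^ (hq q ((q%:R - 1 - (q%:R - 2) * delta
                 - 2 * Num.sqrt ((q%:R - 1) * delta * (1 - delta))) / q%:R)
                       * n%:R + e n))].
Proof.
have q_gt0 : 0 < q%:R :> R by rewrite ltr0n ltnW.
have q_gt1 : (1 < #|Sigma|)%N by rewrite card_Sigma.
split=> [n d d_gt0 n_gt0 dn|n d d_gt0 n_gt0 dn|delta d0 dlt].
- rewrite ler_pdivrMr // -(natrB _ (ltnW q_ge2)) -!natrM ler_nat -card_Sigma => le_qd.
  by apply: chiQ_hamming_linear => //; rewrite [(#|_| * d)%N]mulnC.
- rewrite -mulrBl ltr_pdivrMr // ltr_pdivlMr // => lo hi.
  rewrite -card_Sigma; apply: chiQ_hamming_quadratic => //; rewrite card_Sigma.
    by rewrite subr_gt0 mulrC.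
  have s0 : 0 <= (q%:R - 1) * n%:R - q%:R * d%:R :> R by rewrite subr_ge0 mulrC ltW.
  have x0 : 0 <= (q%:R - 1) * n%:R :> R.
    by apply: le_trans s0 _; rewrite gerBl mulr_ge0.
  rewrite -[ltRHS]sqr_sqrtr // ltr_pXn2r ?nnegrE ?sqrtr_ge0 //.
  by rewrite ltrBlDr -ltrBlDl [q%:R * _]mulrC.
- set tau := (X in hq q X).
  (* The error may depend on [n] only, so [d] is recovered as [D n]. The error is the positive part
     of [excess] when [delta n] is an integer, and 0 otherwise; the value at [d = 0] is a
     placeholder. *)
  pose D n := Num.truncn (delta * n%:R).
  pose excess n d : R := (if d is d'.+1 then
    logq q (chiQ R (hamming_graph Sigma n (ltn0Sn d')))%:R else 0) - hq q tau * n%:R.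
  exists (fun n => if (D n)%:R == delta * n%:R then Num.max 0 (excess n (D n)) else 0).
    apply/eqoP => eps eps0.
    have dlt' : delta < (#|Sigma|%:R - 1) / (#|Sigma|%:R - 1 + 1).
      by rewrite card_Sigma subrK.
    have [N hN] := chiQ_hamming_entropy_ev q_gt1 d0 dlt' eps0.
    exists (maxn N 1) => // n /=; rewrite geq_max => /andP[Nn n_gt0].
    have eps_n : 0 <= eps * n%:R by rewrite mulr_ge0 // ltW.
    rewrite normr_nat; case: eqP => [DE|_]; last by rewrite normr0.
    rewrite ger0_norm ?le_max ?lexx // ge_max eps_n /=.
    have : (D n)%:R = delta * n%:R by [].
    rewrite /excess; case: (D n) => [|d] dE.
      have : 0 < delta * n%:R by rewrite mulr_gt0 // ltr0n.
      by rewrite -dE ltxx.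
    have dn : (d.+1 <= n)%N.
      rewrite -(ler_nat R) dE ler_piMl // ltW // (lt_trans dlt) //.
      by rewrite ltr_pdivrMr // mul1r ltrBlDr ltrDl.
    have := hN n d.+1 (ltn0Sn d) Nn n_gt0 dn dE.
    have q2E : q%:R - 1 - 1 = q%:R - 2 :> R by ring.
    rewrite /krawtchouk_root card_Sigma subrK q2E -/tau.
    by rewrite lerBlDl -mulrDl.
  move=> n d d_gt0 n_gt0 dn dE.
  have -> : D n = d by rewrite /D -dE natrK.
  rewrite dE eqxx; case: d d_gt0 dn dE => // d d_gt0 dn dE.
  set chi := chiQ _ _; have [->|chi_gt0] := posnP chi; first exact: powR_ge0.
  have lnq : 0 < ln q%:R :> R by rewrite ln_gt0 // ltr1n.
  rewrite -[leLHS]lnK ?posrE ?ltr0n // /powR gt_eqF // ler_expR.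
  rewrite -ler_pdivrMr // -lerBlDl le_max; apply/orP; right.
  by rewrite /excess (bool_irrelevance (ltn0Sn d) d_gt0).
Qed.
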